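(* A class $\mathcal C$ of finite graphs has bounded expansion if and only if $\mathcal C$ is weakly sparse and has bounded flip-width.
   Context: Graphs are finite, simple, undirected. For a graph $G$ and $r\in\mathbb N$, $\tilde\nabla_r(G)$ is the maximum of $2|E(H)|/|V(H)|$ over graphs $H$ such that some graph obtained from $H$ by replacing every edge by a path of length at most $r+1$ is a subgraph of $G$; $\mathcal C$ has bounded expansion if $\sup_{G\in\mathcal C}\tilde\nabla_r(G)<\infty$ for all $r$. $\mathcal C$ is weakly sparse if for some $t$ no graph in $\mathcal C$ contains $K_{t,t}$ as a subgraph. A $k$-flip of $G$ is obtained by choosing a partition $\mathcal P$ of $V(G)$ with at most $k$ parts and, for some pairs $A,B$ of (possibly equal) parts, inverting adjacency of every pair of distinct $x\in A,y\in B$. Flipper game of radius $r$ and width $k$: $G_0=G$, runner chooses $v_0$; in round $i\ge1$ the flipper announces a $k$-flip $G_i$ of $G$, the runner moves from $v_{i-1}$ to $v_i$ along a path of length at most $r$ in $G_{i-1}$; the flipper wins if $v_i$ is isolated in $G_i$. $\mathrm{fw}_r(G)$ is the least $k$ for which the flipper has a winning strategy; $\mathcal C$ has bounded flip-width if $\sup_{G\in\mathcal C}\mathrm{fw}_r(G)<\infty$ for every $r\in\mathbb N$. *)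

(* Defs.v *)
From mathcomp Require Import all_boot.
Set Implicit Arguments. Unset Strict Implicit. Unset Printing Implicit Defensive.

Record graph := Graph {
  vert : finType;
  adj : rel vert;
  adj_sym : symmetric adj;
  adj_irr : irreflexive adj }.

Definition graph_class := graph -> Prop.

Definition num_edges (G : graph) : nat :=
  #|[set e : {set vert G} | [exists u, exists v, adj u v && (e == [set u; v])]]|.

(** [shallow_top_minor r H G]: some graph obtained from H by replacing every
    edge by a path of length at most r+1 is a subgraph of G.  [phi] maps
    branch vertices injectively; [P u v] lists the internal vertices of the
    path replacing the edge uv (at most r of them, so length <= r+1); internal
    vertices are distinct, avoid branch vertices, and paths of different
    edges are internally disjoint. *)
Definition shallow_top_minor (r : nat) (H G : graph) : Prop :=
  exists (phi : vert H -> vert G) (P : vert H -> vert H -> seq (vert G)),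
    [/\ injective phi,
        (forall u v, adj u v ->
           [/\ size (P u v) <= r,
               path (@adj G) (phi u) (rcons (P u v) (phi v)),
               uniq (P u v) &
               forall x w, x \in P u v -> x != phi w]) &
        (forall u v u' v', adj u v -> adj u' v' ->
           ~~ (((u == u') && (v == v')) || ((u == v') && (v == u'))) ->
           forall x, x \in P u v -> x \notin P u' v')].

(** Bounded expansion: for every r, sup over G in C of tilde-nabla_r(G) is
    finite, i.e. 2|E(H)|/|V(H)| is uniformly bounded over all r-shallow
    topological minors H of graphs of C. *)
Definition bounded_expansion (C : graph_class) : Prop :=
  forall r : nat, exists c : nat, forall G H : graph,
    C G -> shallow_top_minor r H G -> 2 * num_edges H <= c * #|vert H|.

Definition contains_Ktt (t : nat) (G : graph) : Prop :=
  exists A B : {set vert G},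
    [/\ [disjoint A & B], #|A| = t, #|B| = t &
        forall a b, a \in A -> b \in B -> adj a b].

Definition weakly_sparse (C : graph_class) : Prop :=
  exists t : nat, forall G, C G -> ~ contains_Ktt t G.

(** [H] is a k-flip of [G]: partition given by [part : V -> 'I_k] (at most k
    parts), [F] a symmetric relation on parts (the chosen pairs of possibly
    equal parts); adjacency between distinct x, y is inverted iff
    F (part x) (part y). *)
Definition is_kflip (k : nat) (G : graph) (H : rel (vert G)) : Prop :=
  exists (part : vert G -> 'I_k) (F : rel 'I_k),
    symmetric F /\
    forall x y, H x y = (x != y) && (adj x y (+) F (part x) (part y)).

Definition within (V : finType) (E : rel V) (r : nat) (v w : V) : Prop :=
  exists s : seq V, [/\ size s <= r, path E v s & last v s = w].

Definition isolated (V : finType) (E : rel V) (v : V) : Prop :=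
  forall w, ~~ E v w.

(** Flipper game of radius r and width k on G.  [flipper_wins_from Gcur v]:
    the current graph is Gcur (= G_{i-1}) and the runner is at v (= v_{i-1});
    the flipper can force a win in finitely many rounds.  The flipper
    announces a k-flip Hn (= G_i) of G; for every vertex w the runner can
    reach along a path of length at most r in Gcur, either w is isolated in
    Hn (flipper wins) or the flipper wins from (Hn, w). *)
Inductive flipper_wins_from (r k : nat) (G : graph)
    : rel (vert G) -> vert G -> Prop :=
  | FW_step (Gcur : rel (vert G)) (v : vert G) (Hn : rel (vert G)) :
      @is_kflip k G Hn ->
      (forall w, within Gcur r v w ->
         isolated Hn w \/ @flipper_wins_from r k G Hn w) ->
      @flipper_wins_from r k G Gcur v.

Definition flipper_wins (r k : nat) (G : graph) : Prop :=
  forall v0 : vert G, @flipper_wins_from r k G (@adj G) v0.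

Definition bounded_flip_width (C : graph_class) : Prop :=
  forall r : nat, exists k : nat, forall G, C G -> flipper_wins r k G.

(* Main.v *)
Require Import Defs.
From mathcomp Require Import all_boot.
From mathcomp Require Import zify.
From Stdlib Require Import Classical.
Set Implicit Arguments. Unset Strict Implicit. Unset Printing Implicit Defensive.

(** From right to left: after removing a set S of bounded size, every edge of
    a K_{t,t}-free graph is replaced by a path of length at most 3 in a given
    k-flip.  If G contains a shallow topological minor of minimum degree more
    than 2|S|, the runner survives by moving between branch vertices along
    subdivided edges that avoid S.

    From left to right: by Dvorak's argument, in every nonempty set S of
    vertices some v admits a bounded set hitting all short paths from v to the
    rest of S; otherwise a maximal system of short internally disjoint paths
    between vertices of S, together with large fans leaving an independent set
    of it, is a dense shallow topological minor.  Removing such vertices one by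
    one gives a linear order with bounded strong reachability sets.  The flipper
    isolates the minimum m of the ball reachable by the runner, together with
    everything strongly 3r-reachable from m; the minimum of the runner's next
    ball is then larger than m. *)

(** * Flips of weakly sparse graphs and the escaping runner *)

Lemma leq_card_bigcup (T I : finType) (A : {set I}) (F : I -> {set T}) n :
  (forall i, i \in A -> #|F i| <= n) -> #|\bigcup_(i in A) F i| <= #|A| * n.
Proof.
move=> Fn; rewrite -sum_nat_const.
elim/big_rec2: _ => [|i m B Ai Bm]; first by rewrite cards0.
exact: leq_trans (leq_card_setU _ _) (leq_add (Fn i Ai) Bm).
Qed.

(** Choosing a related element of [B] for each element of [A] is injective. This serves to charge
    obstructed neighbours to the vertices of a small set. *)
Lemma card_le_rel (T U : finType) (A : {set T}) (B : {set U}) (R : U -> T -> Prop) :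
  (forall a, a \in A -> exists2 b, b \in B & R b a) ->
  (forall b a a', a \in A -> a' \in A -> R b a -> R b a' -> a = a') ->
  #|A| <= #|B|.
Proof.
move=> AB injR.
have [->|[a0 Aa0]] := set_0Vmem A; first by rewrite cards0.
have [b0 _ _] := AB _ Aa0.
have /fin_all_exists[f fP] : forall a, exists b, a \in A -> b \in B /\ R b a.
  move=> a; have [/AB[b Bb Rb]|_] := boolP (a \in A); first by exists b.
  by exists b0.
have inj_f : {in A &, injective f}.
  move=> a a' Aa Aa' eq_f; have [_ Ra] := fP _ Aa; have [_ Ra'] := fP _ Aa'.
  by apply: (injR (f a)) => //; rewrite eq_f.
rewrite -(card_in_imset inj_f); apply/subset_leq_card/subsetP => _ /imsetP[a Aa ->].
by case: (fP _ Aa).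
Qed.

Lemma contains_Ktt_geq t (G : graph) (A B : {set vert G}) :
  [disjoint A & B] -> t <= #|A| -> t <= #|B| ->
  (forall a b, a \in A -> b \in B -> adj a b) -> contains_Ktt t G.
Proof.
move=> dAB /card_geqP[sa [ua za subA]] /card_geqP[sb [ub zb subB]] adjAB.
exists [set x in sa], [set x in sb]; split.
- rewrite disjoint_subset; apply/subsetP => x; rewrite !inE => xa.
  by apply/negP => /subB; rewrite (disjointFr dAB (subA _ xa)).
- by rewrite cardsE (card_uniqP ua).
- by rewrite cardsE (card_uniqP ub).
- by move=> a b; rewrite !inE => /subA aA /subB bB; apply: adjAB.
Qed.

Lemma within_leq (V : finType) (E : rel V) r r' v w :
  r <= r' -> within E r v w -> within E r' v w.
Proof. by move=> le_r [s [sz ps ls]]; exists s; split=> //; apply: leq_trans le_r. Qed.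

Lemma within_trans (V : finType) (E : rel V) r r' u v w :
  within E r u v -> within E r' v w -> within E (r + r') u w.
Proof.
move=> [s [sz ps ls]] [s' [sz' ps' ls']]; exists (s ++ s').
by rewrite size_cat leq_add // cat_path last_cat ps ls.
Qed.

Definition short_detours (G : graph) (E : rel (vert G)) (S : {set vert G}) :=
  forall a b, a \notin S -> b \notin S -> adj a b -> within E 3 a b.

(** An edge [ab] off [S] that the flip deletes lies in a flipped pair of parts, so [a] gains
    neighbours [x] in the part of [b], and [b] gains neighbours [y] in the part of [a]. If some such
    [x], [y] are not adjacent in [G], the flip joins them and a, x, y, b is a detour; otherwise they
    contain a [K_{t,t}]. [S] collects the small parts and the vertices adjacent to almost all of a
    large part. *)
Lemma flip_short_detours k t (G : graph) (E : rel (vert G)) :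
  is_kflip k E -> ~ contains_Ktt t G ->
  exists2 S : {set vert G},
    #|S| <= k * ((2 * t * t + 2 * t) + t) & short_detours E S.
Proof.
(* Removing [t] heavy vertices and their fewer than [2 * t] non-neighbours each from a part of size
   [m] leaves [t] common neighbours. The threshold [2 * t] leaves [t] choices of [y] outside the [t]
   chosen [x], also when the two parts coincide. *)
move=> [part [F [symF EE]]] noK; set m := 2 * t * t + 2 * t.
pose A i := [set x | part x == i].
pose far a i := [set x in A i | (x != a) && ~~ adj a x].
(* Fewer than [t] vertices are heavy for a large part: [t] of them would
   have [t] common neighbours in it. *)
pose hvy i := [set a : vert G | #|far a i| < 2 * t].
pose S := \bigcup_(i in [set: 'I_k]) (if #|A i| < m then A i else hvy i).
exists S.
  rewrite -[X in _ <= X * _]card_ord -cardsT; apply: leq_card_bigcup => i _.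
  case: ltnP => [lt_m|le_m]; first by rewrite (leq_trans (ltnW lt_m)) ?leq_addr.
  have [/ltnW le_t|ge_t] := ltnP #|hvy i| t; first by rewrite (leq_trans le_t) ?leq_addl.
  have /card_geqP[q [uq zq qh]] := ge_t; case: noK.
  pose Q := [set x in q].
  have cQ : #|Q| = t by rewrite cardsE (card_uniqP uq).
  pose N := \bigcup_(a in Q) far a i.
  have cN : #|N| <= t * (2 * t).
    rewrite -cQ; apply: leq_card_bigcup => a; rewrite inE => /qh.
    by rewrite inE cQ => /ltnW.
  have cB : t <= #|A i :\: (Q :|: N)|.
    have := (leq_card_setU Q N).1; have := cardsID (Q :|: N) (A i).
    have := subset_leq_card (subsetIr (A i) (Q :|: N)); rewrite cQ.
    by move: le_m cN; rewrite /m mulnCA -mulnA; lia.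
  apply: (contains_Ktt_geq (A := Q) (B := A i :\: (Q :|: N))) => //.
  - rewrite disjoint_subset; apply/subsetP => x; rewrite !inE => ->.
    by rewrite orTb andFb.
  - by rewrite cQ.
  move=> a b Qa; rewrite !inE negb_or -!andbA => /and3P[nQb nNb Ab].
  apply: contraR nNb => nab; apply/bigcupP; exists a => //.
  rewrite !inE Ab nab andbT; apply: contraNneq nQb => ->; by move: Qa; rewrite inE.
have manyfar a i b : a \notin S -> b \notin S -> part b = i -> 2 * t <= #|far a i|.
  move=> nSa nSb pb; rewrite leqNgt; apply/negP => lt_t.
  have [Asm|Abig] := ltnP #|A i| m.
    by case/negP: nSb; apply/bigcupP; exists i; rewrite ?inE // Asm inE pb.
  case/negP: nSa; apply/bigcupP; exists i; rewrite ?inE //.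
  by rewrite ltnNge Abig inE.
move=> a b nSa nSb ab.
have neq_ab : a != b by apply: contraTneq ab => ->; rewrite adj_irr.
have [Fab|nFab] := boolP (F (part a) (part b)); last first.
  by exists [:: b]; split=> //=; rewrite EE neq_ab ab (negPf nFab).
have fara := manyfar a _ b nSa nSb erefl.
have farb := manyfar b _ a nSb nSa erefl.
have /card_geqP[xs [ux zx xsub]] : t <= #|far a (part b)| by lia.
pose X := [set x in xs].
have cX : #|X| = t by rewrite cardsE (card_uniqP ux).
have cY : t <= #|far b (part a) :\: X|.
  have := cardsID X (far b (part a)).
  have := subset_leq_card (subsetIr (far b (part a)) X); rewrite cX; lia.
have [//|noedge] := classic (within E 3 a b); case: noK.
apply: (contains_Ktt_geq (A := X) (B := far b (part a) :\: X)) => //.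
- rewrite disjoint_subset; apply/subsetP => x; rewrite !inE => ->.
  by rewrite andFb.
- by rewrite cX.
move=> x y; rewrite inE => xin; have := xsub _ xin; rewrite !inE => /and3P[/eqP px xa nax].
move=> /andP[nXy] /and3P[/eqP py yb nby].
have [//|nxy] := boolP (adj x y). case: noedge.
have neq_xy : x != y by apply: contraNneq nXy => <-.
exists [:: x; y; b]; split=> //=.
rewrite !EE px py (eq_sym a) xa neq_xy yb (negPf nax) (symF (part b)) Fab (negPf nxy).
by rewrite [adj y b]adj_sym (negPf nby).
Qed.

(** Otherwise every nonempty set has a vertex with at most [D] neighbours inside it, and deleting
    such vertices one by one loses at most [D] edges each time. *)
Lemma min_degree_subset D (H : graph) :
  D * #|vert H| < num_edges H ->
  exists2 W : {set vert H}, W != set0 &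
    forall w, w \in W -> D < #|[set w' in W | adj w w']|.
Proof.
rewrite /num_edges; set E := [set e | _] => ltE; apply: NNPP => noW.
suff: forall n (W : {set vert H}), #|W| <= n ->
    #|[set e in E | e \subset W]| <= D * #|W|.
  move=> /(_ _ [set: vert H] (leqnn _)); rewrite cardsT leqNgt.
  move=> /negP[]; apply: leq_trans ltE _; apply/subset_leq_card/subsetP => e Ee.
  by rewrite inE Ee subsetT.
elim=> [|n IHn] W leW.
  suff -> : [set e in E | e \subset W] = set0 by rewrite cards0.
  move: leW; rewrite leqn0 cards_eq0 => /eqP ->; apply/setP => e; rewrite !inE subset0.
  by apply/negP => /andP[/existsP[u /existsP[v /andP[_ /eqP->]]] /eqP/setP/(_ u)]; rewrite !inE eqxx.
have [->|[w0 Ww0]] := set_0Vmem W.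
  by apply: IHn; rewrite cards0.
have [w Ww degw] : exists2 w, w \in W & #|[set w' in W | adj w w']| <= D.
  apply: NNPP => now; apply: noW; exists W; first by apply/set0Pn; exists w0.
  by move=> w Ww; rewrite ltnNge; apply/negP => degw; apply: now; exists w.
pose N := [set w' in W | adj w w'].
have cW := cardsD1 w W; rewrite Ww /= in cW.
apply: (@leq_trans #|[set e in E | e \subset W :\ w] :|: [set [set w; w'] | w' in N]|).
  apply/subset_leq_card/subsetP => e; rewrite !inE => /andP[Ee eW].
  rewrite Ee /=; case/existsP: Ee => u /existsP[v /andP[uv /eqP def_e]].
  have [Wu Wv] : u \in W /\ v \in W.
    by split; apply: (subsetP eW); rewrite def_e !inE eqxx ?orbT.
  have [eq_wu|neq_u] := eqVneq w u.
    by apply/orP; right; apply/imsetP; exists v; rewrite ?inE ?Wv eq_wu.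
  have [eq_wv|neq_v] := eqVneq w v.
    by apply/orP; right; apply/imsetP; exists u; rewrite ?inE ?Wu eq_wv ?def_e 1?setUC // adj_sym.
  by rewrite def_e subUset !sub1set !inE Wu Wv eq_sym neq_u eq_sym neq_v.
apply: leq_trans (leq_card_setU _ _).1 _; rewrite cW mulnDr muln1 addnC leq_add //.
  exact: leq_trans (leq_imset_card _ _) degw.
by apply: IHn; rewrite cW in leW.
Qed.

Lemma within_detours (G : graph) (E : rel (vert G)) (S : {set vert G}) a s :
  short_detours E S -> path (@adj G) a s -> all [predC S] (a :: s) ->
  within E (3 * size s) a (last a s).
Proof.
move=> det; elim: s a => [|b s IHs] a /=; first by exists [::].
move=> /andP[ab ps] /and3P[Sa Sb Ss]; rewrite mulnS.
by apply: within_trans (det _ _ Sa Sb ab) (IHs _ ps _); rewrite /= Sb.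
Qed.

(* The generated induction principle gives no hypothesis under the disjunction. *)
Lemma flipper_wins_from_ind_nested (r k : nat) (G : graph)
    (Q : rel (vert G) -> vert G -> Prop) :
  (forall E v E', is_kflip k E' ->
     (forall w, within E r v w -> isolated E' w \/ Q E' w) -> Q E v) ->
  forall E v, flipper_wins_from r k E v -> Q E v.
Proof.
move=> IH; fix rec 3 => E v [{}E {}v E' flipE' win].
by apply: (IH E v E') => // w /win[iso|/rec]; [left|right].
Qed.

Section Runner.
Variables (r k t : nat) (G H : graph) (phi : vert H -> vert G).
Variables (P : vert H -> vert H -> seq (vert G)).
Hypothesis inj_phi : injective phi.
Hypothesis pathP : forall u v, adj u v ->
  [/\ size (P u v) <= r, path (@adj G) (phi u) (rcons (P u v) (phi v)),
      uniq (P u v) & forall x w, x \in P u v -> x != phi w].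
Hypothesis disjP : forall u v u' v', adj u v -> adj u' v' ->
  ~~ (((u == u') && (v == v')) || ((u == v') && (v == u'))) ->
  forall x, x \in P u v -> x \notin P u' v'.
Variables (s : nat) (W : {set vert H}).
Hypothesis degW : forall w, w \in W -> 2 * s < #|[set w' in W | adj w w']|.

(** A neighbour [w'] is bad if [phi w'] lies in [S'] or its path meets [S]. The paths leaving
    [phi w] share no further vertex, so each vertex of [S] or [S'] spoils at most one neighbour: at
    most [2 * s] in all. *)
Lemma escape (S S' : {set vert G}) w : #|S| <= s -> #|S'| <= s -> w \in W ->
  exists w', [/\ w' \in W, adj w w', phi w' \notin S' &
              all [predC S] (rcons (P w w') (phi w'))].
Proof.
move=> leS leS' Ww; pose N := [set w' in W | adj w w'].
pose B1 := [set w' in N | phi w' \in S'].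
pose B2 := [set w' in N | has [in S] (rcons (P w w') (phi w'))].
have leB1 : #|B1| <= s.
  apply: leq_trans leS'; apply: (card_le_rel (R := fun x w' => x = phi w')).
    by move=> w'; rewrite inE => /andP[_ S'w']; exists (phi w').
  by move=> x w1 w2 _ _ -> /inj_phi.
have leB2 : #|B2| <= s.
  apply: leq_trans leS.
  apply: (card_le_rel (R := fun x w' => x \in rcons (P w w') (phi w'))).
    by move=> w'; rewrite inE => /andP[_ /hasP[x xin Sx]]; exists x.
  have B2adj w' : w' \in B2 -> adj w w' by rewrite !inE => /andP[/andP[]].
  move=> x w1 w2 /B2adj ww1 /B2adj ww2.
  have [_ _ _ av1] := pathP ww1; have [_ _ _ av2] := pathP ww2.
  rewrite !mem_rcons !inE => /orP[/eqP->|x1] /orP[/eqP eq2|x2].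
  - exact: inj_phi.
  - by have := av2 _ w1 x2; rewrite eqxx.
  - by have := av1 _ w2 x1; rewrite eq2 eqxx.
  apply/eqP; apply: contraTT x2 => neq12; apply: (disjP ww1 ww2) => //.
  rewrite eqxx (negPf neq12) /=; apply: contraTN ww2 => /andP[/eqP-> _].
  by rewrite adj_irr.
have [w' Nw' nB] : exists2 w', w' \in N & w' \notin B1 :|: B2.
  apply/subsetPn/negP => /subset_leq_card.
  by have := (leq_card_setU B1 B2).1; have := degW Ww; rewrite -/N; lia.
exists w'; move: Nw' nB; rewrite !inE => /andP[-> ->] /=.
by rewrite negb_or => /andP[nS' nS]; split=> //; rewrite all_predC.
Qed.

(** The invariant is that the runner stands on a branch vertex of [W] outside a set [S] of at most
    [s] vertices off which the current graph has short detours. A subdivided edge has length at most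
    [r.+1] and each of its edges costs at most 3 moves, hence the radius. *)
Lemma runner_evades :
  ~ contains_Ktt t G -> k * ((2 * t * t + 2 * t) + t) <= s -> W != set0 ->
  ~ flipper_wins (3 * r.+1) k G.
Proof.
move=> noK les /set0Pn[w0 Ww0] /(_ (phi w0)) win.
suff evade E v : flipper_wins_from (3 * r.+1) k E v ->
    forall (S : {set vert G}) w, #|S| <= s -> short_detours E S -> w \in W ->
    v = phi w -> phi w \notin S -> False.
  apply: (evade _ _ win set0 w0); rewrite ?cards0 ?inE //.
  by move=> a b _ _ ab; exists [:: b]; rewrite /= ab.
move: E v; apply: flipper_wins_from_ind_nested => E v E' flipE' IH S w leS detS Ww def_v nSw.
have [S' leS' detS'] := flip_short_detours flipE' noK.
have {}leS' := leq_trans leS' les.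
have [w' [Ww' ww' nS'w' avS]] := escape leS leS' Ww.
have [szP pP _ _] := pathP ww'.
have reach : within E (3 * r.+1) v (phi w').
  have := within_detours detS pP; rewrite last_rcons size_rcons def_v => /(_ _).
  by move=> dw; apply: within_leq (dw _); [rewrite leq_mul2l ltnS|rewrite /= nSw].
case: (IH _ reach) => [iso|]; last by apply; eauto.
(* [phi w'] is not isolated in [E']: it starts an edge of [G] avoiding [S'], whose detour in [E'] is
   nonempty because its ends differ. *)
have [w'' [_ ww'' _ avS']] := escape leS' leS' Ww'.
have [_] := pathP ww''; case def_p: (rcons (P w' w'') _) avS' => [|y p] /=.
  by case: (P _ _) def_p.
move=> /andP[nSy _] /andP[w'y _] _ _.
have [[|z q] [_ /= pq lq]] := detS' _ _ nS'w' nSy w'y.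
  by rewrite lq adj_irr in w'y.
by case/andP: pq => w'z _; have := iso z; rewrite w'z.
Qed.
End Runner.

Lemma bounded_expansion_of_flip_width (C : graph_class) :
  weakly_sparse C -> bounded_flip_width C -> bounded_expansion C.
Proof.
move=> [t sparse] fw r; have [k win] := fw (3 * r.+1).
(* The inner [2 * s] is the degree that [escape] requires; the outer 2 matches the factor in
   [2 * num_edges H]. *)
pose s := k * ((2 * t * t + 2 * t) + t); exists (2 * (2 * s)).
move=> G H CG [phi [P [inj_phi pathP disjP]]].
rewrite -mulnA leq_mul2l /= leqNgt; apply/negP => /min_degree_subset[W W0 degW].
exact: (runner_evades inj_phi pathP disjP degW (sparse _ CG) (leqnn _) W0 (win _ CG)).
Qed.

(** * Systems of disjoint paths *)

Lemma maximal_list (T : Type) (good : seq T -> Prop) N :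
  good [::] -> (forall L, good L -> size L <= N) ->
  exists2 L, good L & forall x, ~ good (x :: L).
Proof.
move=> good0 leN.
suff: forall n L, N - size L <= n -> good L ->
    exists2 L, good L & forall x, ~ good (x :: L).
  by move=> /(_ _ [::] (leqnn _)); apply.
elim=> [|n IHn] L le_n gL; have [[x gx]|nx] := classic (exists x, good (x :: L)).
- by have := leN _ gx; rewrite /=; lia.
- by exists L => // x gx; apply: nx; exists x.
- by apply: IHn gx; rewrite /=; lia.
- by exists L => // x gx; apply: nx; exists x.
Qed.

Lemma pairwise_neq (T : eqType) (r : rel T) (s : seq T) x y :
  symmetric r -> pairwise r s -> x \in s -> y \in s -> x != y -> r x y.
Proof.
move=> r_sym; elim: s => //= z s IHs /andP[/allP rz pw].
rewrite !inE => /orP[/eqP->|xs] /orP[/eqP->|ys]; rewrite ?eqxx //.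
- by move=> _; apply: rz.
- by move=> _; rewrite r_sym; apply: rz.
- exact: IHs.
Qed.

Section Links.
Variable G : graph.
Local Notation V := (vert G).
Implicit Types (u v w x : V) (z : V * V * seq V) (L : seq (V * V * seq V)) (B : {set V}).

Definition joins u v z :=
  ((z.1.1 == u) && (z.1.2 == v)) || ((z.1.1 == v) && (z.1.2 == u)).

(* A link [(u, v, p)] is a path from [u] to [v] with internal vertices [p]. *)
Definition is_link q B z :=
  [&& z.1.1 \in B, z.1.2 \in B, z.1.1 != z.1.2, size z.2 <= q,
      path (@adj G) z.1.1 (rcons z.2 z.1.2), uniq z.2 & all [predC B] z.2].

Definition compatible z z' :=
  ~~ joins z'.1.1 z'.1.2 z && ~~ has [in z'.2] z.2.

(** This encodes a [q]-shallow topological minor with branch set [B], one link per edge; a list is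
    easy to extend greedily. *)
Definition link_system q B L := all (is_link q B) L && pairwise compatible L.

Lemma joinsC u v z : joins u v z = joins v u z.
Proof. by rewrite /joins orbC. Qed.

Lemma compatible_sym : symmetric compatible.
Proof.
move=> [[a b] p] [[a' b'] p']; rewrite /compatible /joins /= has_sym; congr (_ && _).
rewrite !(eq_sym a) !(eq_sym b); congr (~~ (_ || _)); exact: andbC.
Qed.

Lemma path_rcons_rev u p v :
  path (@adj G) u (rcons p v) -> path (@adj G) v (rcons (rev p) u).
Proof.
have := rev_path (@adj G) u (rcons p v).
rewrite last_rcons belast_rcons rev_cons => ->.
by apply: sub_path => x y; rewrite adj_sym.
Qed.

Lemma link_system_minor q B L : link_system q B L ->
  exists2 H, shallow_top_minor q H G & #|vert H| = #|B| /\ size L <= num_edges H.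
Proof.
move=> /andP[/allP linkL pwL].
pose T := {x | x \in B}.
pose e : rel T := fun a b => has (joins (val a) (val b)) L.
have e_sym : symmetric e.
  by move=> a b; apply: eq_has => z; rewrite joinsC.
have e_irr : irreflexive e.
  move=> a; apply/negP => /hasP[z /linkL /and4P[_ _ neq _]].
  by rewrite /joins orbb => /andP[/eqP za /eqP zb]; rewrite za zb eqxx in neq.
pose H := Graph e_sym e_irr.
(* The default of [nth] is never reached on an edge, where [find] succeeds. A link is stored in one
   direction only, so [P] reverses it when the edge is read from its other end. *)
pose z0 (a b : T) : V * V * seq V := nth (val a, val b, [::]) L (find (joins (val a) (val b)) L).
pose P (a b : T) := if (z0 a b).1.1 == val a then (z0 a b).2 else rev (z0 a b).2.
have z0P a b : e a b -> z0 a b \in L /\ joins (val a) (val b) (z0 a b).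
  by move=> eab; rewrite /z0 nth_find // mem_nth // -has_find.
have memP a b : P a b =i (z0 a b).2 by move=> x; rewrite /P; case: ifP; rewrite ?mem_rev.
exists H; [exists val, P; split|split].
- exact: val_inj.
- move=> a b /z0P[/linkL /and4P[_ _ neq /and4P[sz pz uz avz]] jz]; split.
  + by rewrite /P; case: ifP; rewrite ?size_rev.
  + rewrite /P; case/orP: jz => /andP[/eqP za /eqP zb]; move: neq pz; rewrite za zb.
      by rewrite eqxx.
    by move=> /negPf-> /path_rcons_rev.
  + by rewrite /P; case: ifP; rewrite ?rev_uniq.
  + move=> x w; rewrite memP => /(allP avz) /=; apply: contraNneq => ->; exact: valP.
- move=> a b a' b' /z0P[zL jz] /z0P[zL' jz'] nsame x; rewrite !memP => xz.
  have neq : z0 a b != z0 a' b'.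
    apply: contraNneq nsame => eqz; move: jz jz'; rewrite -eqz /joins -!(inj_eq val_inj) /=.
    have /and3P[_ _ /andP[neq _]] := linkL _ zL.
    do 2![case/orP=> /andP[/eqP<- /eqP<-]]; rewrite ?eqxx ?orbT //.
  have : compatible (z0 a b) (z0 a' b').
    exact: pairwise_neq compatible_sym pwL zL zL' neq.
  by move=> /andP[_ /hasPn/(_ _ xz)].
- by rewrite card_sig.
(* Compatible links have different pairs of ends, so [ed] maps [L] injectively to edges of [H]. *)
pose ed z : {set T} := [set a | (val a == z.1.1) || (val a == z.1.2)].
have /card_uniqP : uniq (map ed L).
  rewrite uniq_pairwise pairwise_map.
  apply: sub_in_pairwise (pwL) => [z z' /linkL zL /linkL zL' /andP[nj _]|]; last exact/allP.
  have /and3P[B1 B2 /andP[neq _]] := zL; have /and3P[B1' B2' _] := zL'.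
  apply: contraNneq nj => /setP eq_ed.
  have := eq_ed (exist (fun x => x \in B) _ B1).
  have := eq_ed (exist (fun x => x \in B) _ B2).
  rewrite !inE /= !eqxx ?orbT /joins /= => j2 j1.
  move: neq; case/orP: (esym j1) => /eqP->; case/orP: (esym j2) => /eqP->; rewrite !eqxx ?orbT //=.
rewrite size_map => <-; apply/subset_leq_card/subsetP => _ /mapP[z zL ->]; rewrite inE.
have /and3P[B1 B2 _] := linkL _ zL.
apply/existsP; exists (exist (fun x => x \in B) _ B1).
apply/existsP; exists (exist (fun x => x \in B) _ B2).
apply/andP; split; first by apply/hasP; exists z; rewrite // /joins !eqxx.
by apply/eqP/setP => a; rewrite !inE -!(inj_eq val_inj).
Qed.
End Links.

(** Greedy choice: taking a vertex of degree at most [c] and discarding its neighbours spends at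
    most [c.+1] vertices of [S] per vertex of [R]. *)
Lemma independent_subset (V : finType) (e : rel V) c (S : {set V}) :
  symmetric e ->
  (forall T : {set V}, T \subset S -> T != set0 ->
     exists2 v, v \in T & #|[set u in T | e v u]| <= c) ->
  exists R : {set V}, [/\ R \subset S,
    forall u v, u \in R -> v \in R -> u != v -> ~~ e u v & #|S| <= c.+1 * #|R|].
Proof.
move=> e_sym; have [n] := ubnP #|S|; elim: n S => // n IHn S; rewrite ltnS => leS deg.
have [->|S0] := eqVneq S set0.
  by exists set0; rewrite sub0set cards0; split=> // u v; rewrite inE.
have [v Sv degv] := deg _ (subxx S) S0.
pose N := v |: [set u in S | e v u].
have cN : #|N| <= c.+1.
  by rewrite (leq_trans (leq_card_setU _ _).1) // cards1 add1n ltnS.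
have cS : #|S :\: N| < #|S|.
  by apply/proper_card/properP; split; [exact: subsetDl|exists v; rewrite // !inE eqxx].
have [|T TS|R [RS indR leR]] := IHn (S :\: N).
- by rewrite (leq_trans cS).
- by apply: deg; apply: subset_trans TS (subsetDl _ _).
have Rv u : u \in R -> (u != v) && ~~ e v u.
  move=> /(subsetP RS); rewrite !inE negb_or negb_and => /andP[/andP[-> /orP[/negP|->]]] //.
exists (v |: R); split.
- by rewrite subUset sub1set Sv (subset_trans RS) ?subsetDl.
- move=> x y; rewrite !inE => /orP[/eqP->|Rx] /orP[/eqP->|Ry]; rewrite ?eqxx //.
  + by case/andP: (Rv _ Ry).
  + by rewrite e_sym; case/andP: (Rv _ Rx).
  + exact: indR.
have vR : v \notin R by apply/negP => /Rv; rewrite eqxx.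
rewrite cardsU1 vR mulnDr muln1 -(cardsID N S) leq_add //.
by apply: leq_trans (subset_leq_card (subsetIr _ _)) cN.
Qed.

Lemma first_hit (T : Type) (a : pred T) s : has a s ->
  exists p w s', [/\ s = p ++ w :: s', a w & all (predC a) p].
Proof.
elim: s => //= x s IHs; have [ax _|nax /IHs[p [w [s' [-> aw ap]]]]] := boolP (a x).
  by exists [::], x, s.
by exists (x :: p), w, s'; rewrite /= nax.
Qed.

Lemma path_uniq_rcons (T : eqType) (e : rel T) v p w :
  path e v (rcons p w) -> v != w ->
  exists p', [/\ path e v (rcons p' w), uniq (v :: rcons p' w),
                 size p' <= size p & {subset p' <= p}].
Proof.
move=> pth; have := last_rcons v p w.
case: (shortenP pth) => s' ps' us' sub; case: (lastP s') us' ps' sub => [_ _ _ /= ->|p' w'].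
  by rewrite eqxx.
rewrite last_rcons => us' ps' sub def_w _; rewrite def_w in us' ps' sub.
exists p'; split=> //.
  rewrite -ltnS -(size_rcons p' w) -(size_rcons p w).
  by apply: uniq_leq_size => //; case/andP: us'.
move=> x xp'; have := sub x; rewrite !mem_rcons !inE xp' orbT => /(_ isT) /orP[/eqP xw|//].
by move: us'; rewrite /= rcons_uniq -xw xp' /= andbF.
Qed.

Lemma size_flatten_map (T U : Type) (f : T -> seq U) n s :
  all (fun x => size (f x) <= n) s -> size (flatten (map f s)) <= size s * n.
Proof.
elim: s => //= x s IHs /andP[lex /IHs les].
by rewrite size_cat mulSn leq_add.
Qed.

Lemma card_seq_leq (T : finType) (s : seq T) : #|[set x in s]| <= size s.
Proof. by rewrite cardsE card_size. Qed.

(** This is a hitting-set form of admissibility. Simplicity of the path prevents a return to [v], so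
    [v] itself never counts as the vertex of [S] that is reached. *)
Definition hits r (G : graph) (S : {set vert G}) v (M : {set vert G}) :=
  forall s, path (@adj G) v s -> size s <= r -> uniq (v :: s) ->
    has [in S] s -> has [in M] s.

(** * Hitting sets for short paths in sparse graphs *)

Section Dense.
Variables (G : graph) (r c : nat).
Local Notation V := (vert G).
Let q := 2 * r.
Hypothesis sparse : forall (B : {set V}) L, link_system q B L -> 2 * size L <= c * #|B|.

(** The links with both ends in [T] form a link system on [T], so the average degree in [T] is at
    most [c]. *)
Lemma link_system_sparse_vertex (S T : {set V}) L :
  link_system q S L -> T \subset S -> T != set0 ->
  exists2 v, v \in T & #|[set u in T | has (joins v u) L]| <= c.
Proof.
move=> /andP[/allP linkL pwL] TS T0.
pose LT := [seq z <- L | (z.1.1 \in T) && (z.1.2 \in T)].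
have sizeLT : 2 * size LT <= c * #|T|.
  apply: sparse; rewrite /link_system pairwise_filter // andbT.
  apply/allP => z; rewrite mem_filter => /andP[/andP[T1 T2] /linkL].
  case/and5P=> _ _ neq sz /and3P[pz uz avz]; rewrite /is_link T1 T2 neq sz pz uz /=.
  by apply: sub_all avz => x /=; apply: contra; apply: subsetP.
pose inc v (z : V * V * seq V) := (z.1.1 == v) || (z.1.2 == v).
have deg_count v : v \in T -> #|[set u in T | has (joins v u) L]| <= count (inc v) LT.
  move=> Tv; pose other (z : V * V * seq V) := if z.1.1 == v then z.1.2 else z.1.1.
  rewrite -size_filter -(size_map other); apply: leq_trans (card_seq_leq _).
  apply/subset_leq_card/subsetP => u; rewrite !inE => /andP[Tu /hasP[z zL jz]].
  apply/mapP; exists z; last first.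
    by move: jz; rewrite /joins /other => /orP[/andP[-> /eqP]|/andP[/eqP-> /eqP->]] //; case: eqP.
  rewrite !mem_filter zL /inc andbT.
  by case/orP: jz => /andP[/eqP-> /eqP->]; rewrite eqxx ?orbT Tu Tv.
have sum_count : \sum_(v in T) count (inc v) LT <= size LT * 2.
  elim: LT {sizeLT deg_count} => [|z s IHs] /=; first by rewrite big1.
  rewrite big_split mulSn /= leq_add // -big_mkcondr sum1dep_card.
  apply: (@leq_trans #|[set z.1.1; z.1.2]|); last by rewrite cards2; case: eqP.
  apply/subset_leq_card/subsetP => v; rewrite !inE => /andP[_ /orP[]/eqP->];
    by rewrite eqxx ?orbT.
apply: NNPP => nov; have: \sum_(v in T) c.+1 <= \sum_(v in T) count (inc v) LT.
  apply: leq_sum => v Tv; apply: leq_trans (deg_count v Tv).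
  by rewrite ltnNge; apply/negP => le; apply: nov; exists v.
rewrite sum_nat_const; move: T0; rewrite -card_gt0; nia.
Qed.

Lemma link_system_link (B : {set V}) L z : link_system q B L -> z \in L -> is_link q B z.
Proof. by move=> /andP[/allP linkL _]; apply: linkL. Qed.

(** The contradiction comes from a link system on [U]: [#|U|] is linear in [#|R|], while each vertex
    of [R] contributes more than [b] links. *)
Lemma hitting_set (S : {set V}) : S != set0 ->
  exists2 v, v \in S & exists2 M : {set V},
    #|M| <= c * (c.+1 * (1 + q * c)) * r.+1 & hits r S v M.
Proof.
(* [b] bounds the number of links in a fan, and [r.+1] counts the far end and the at most [r]
   internal vertices of each. It stays opaque until the final computation. *)
move=> S0; have [b def_b] : exists b, b = c * (c.+1 * (1 + q * c))
  by exists (c * (c.+1 * (1 + q * c))).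
rewrite -def_b.
apply: NNPP => nohit.
have escape v (M : {set V}) : v \in S -> #|M| <= b * r.+1 -> exists s,
    [/\ path (@adj G) v s, size s <= r, uniq (v :: s), has [in S] s & ~~ has [in M] s].
  move=> Sv leM; apply: NNPP => nos; apply: nohit; exists v => //; exists M => // s ps ss us hs.
  by apply/negPn/negP => nh; apply: nos; exists s.
have [|L sysL maxL] := @maximal_list _ (link_system q S) (c * #|S|) isT.
  by move=> L /sparse; lia.
have [//||R [RS indR leR]] := @independent_subset _ (fun u v => has (joins u v) L) c S.
- by move=> u v; apply: eq_has => z; rewrite joinsC.
- by move=> T; apply: link_system_sparse_vertex.
pose M := [set x in flatten (map snd L)]; pose U := S :|: M.
have leM : 2 * #|M| <= c * #|S| * q.
  apply: leq_trans (_ : 2 * (size L * q) <= _).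
    rewrite leq_mul2l /=; apply: leq_trans (card_seq_leq _) (size_flatten_map _).
    by apply/allP => z /(link_system_link sysL) /and5P[].
  by rewrite mulnA leq_mul2r (sparse sysL) orbT.
have avU x p : x \in p -> all [predC U] p -> (x \notin S) * (x \notin M).
  by move=> xp /allP/(_ _ xp); rewrite /= inE negb_or => /andP[-> ->].
(* Such a path could be added to the maximal system [L]. *)
have notconn v v' p : v \in R -> v' \in R -> v != v' ->
    path (@adj G) v (rcons p v') -> size p <= q -> all [predC U] p -> False.
  move=> Rv Rv' neq pp sz av.
  have [p' [pp' up' sz' sub']] := path_uniq_rcons pp neq.
  apply: (maxL (v, v', p')); rewrite /link_system /=.
  case/andP: sysL => -> pwL; rewrite pwL !andbT.
  move: up'; rewrite /= rcons_uniq => /and3P[_ _ up'].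
  rewrite /is_link /= (subsetP RS _ Rv) (subsetP RS _ Rv') neq (leq_trans sz') // pp' up' /=.
  apply/andP; split; first by apply/allP => x /sub' xp; rewrite /= (avU _ _ xp av).
  apply/allP => z zL; rewrite compatible_sym /compatible /=.
  have := indR _ _ Rv Rv' neq => /hasPn/(_ _ zL) ->; apply/hasPn => x xz.
  apply: contraL xz => /sub' xp; have := (avU _ _ xp av).2; apply: contra => xz.
  by rewrite inE; apply/flattenP; exists z.2 => //; apply: map_f.
pose fan v Q := link_system q U Q && all (fun z => (z.1.1 == v) && (size z.2 <= r)) Q.
(* The vertices of a maximal fan with at most [b] paths would form a hitting set. *)
have fanP v : exists Q, v \in R -> fan v Q /\ b < size Q.
  have [Rv|_] := boolP (v \in R); last by exists [::].
  have [|Q fanQ maxQ] := @maximal_list _ (fan v) (c * #|U|) isT.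
    by move=> Q /andP[/sparse + _]; lia.
  exists Q => _; split=> //; rewrite ltnNge; apply/negP => leQ.
  have [sysQ /allP fQ] := andP fanQ.
  have Sv := subsetP RS _ Rv.
  have [|s [ps ss us hs nhs]] := escape v [set x in flatten [seq z.1.2 :: z.2 | z <- Q]] Sv.
    apply: leq_trans (card_seq_leq _) (leq_trans (size_flatten_map (n := r.+1) _) _).
      by apply/allP => z /fQ /andP[_]; rewrite /= ltnS.
    by rewrite leq_mul2r leQ orbT.
  (* Cut at its first vertex in [U], the escaping path has its interior off [U] and is a new link of
     the fan. *)
  have {}hs : has [in U] s.
    by apply: sub_has hs => x /= Sx; rewrite inE Sx.
  have [p [w [s' [def_s Uw avp]]]] := first_hit hs.
  rewrite def_s -cat_rcons in ps ss us nhs.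
  apply: (maxQ (v, w, p)); rewrite /fan /link_system /= eqxx.
  have [-> ->] := andP sysQ.
  have le_p : size p <= r by apply: leq_trans ss; rewrite size_cat size_rcons addSnnS leq_addr.
  move: ps us; rewrite cat_path /= cat_uniq mem_cat mem_rcons inE rcons_uniq !negb_or.
  move=> /andP[pp _] /andP[/andP[/andP[neq vp] _] /andP[/andP[wp up] _]].
  rewrite /is_link /= inE Sv Uw neq (leq_trans le_p) ?leq_pmull // pp up avp le_p.
  rewrite andbT /=; case/andP: fanQ => _ ->; rewrite !andbT.
  apply/allP => z zQ; have [/eqP zv _] := andP (fQ _ zQ).
  have nz x : x \in rcons p w -> x \notin z.1.2 :: z.2.
    move=> xp; have : ~~ has [in flatten [seq z.1.2 :: z.2 | z <- Q]] (rcons p w ++ s').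
      by apply: contra nhs => /hasP[y ys yQ]; apply/hasP; exists y; rewrite ?inE.
    move=> /hasPn/(_ x); rewrite mem_cat xp => /(_ isT); apply: contra => xz.
    by apply/flattenP; exists (z.1.2 :: z.2) => //; apply: (map_f (fun z => z.1.2 :: z.2)).
  have := nz w; rewrite mem_rcons mem_head inE negb_or => /(_ isT) /andP[wz _].
  rewrite /compatible /joins /= zv eqxx (negPf wz) /=.
  rewrite [w == v]eq_sym (negPf neq) andbF /=; apply/hasPn => x xp.
  by have := nz x; rewrite mem_rcons !inE xp orbT => /(_ isT) /norP[].
have [Q QP] := fin_all_exists fanP.
(* Fans from different vertices of [R] are compatible: otherwise two vertices of [R] would be joined
   as [notconn] forbids. *)
have sysQ : link_system q U (flatten [seq Q v | v <- enum R]).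
  have : uniq (enum R) := enum_uniq _.
  have : {subset enum R <= R} by move=> v; rewrite mem_enum.
  elim: (enum R) => //= v vs IHvs sub /andP[nvs uvs].
  have Rv : v \in R by apply: sub; rewrite mem_head.
  have {sub} sub : {subset vs <= R} by move=> x xv; apply: sub; rewrite inE xv orbT.
  have [/andP[/andP[linkQ pwQ] /allP fQ] _] := QP _ Rv.
  have /andP[linkQs pwQs] := IHvs sub uvs.
  rewrite /link_system all_cat linkQ linkQs pairwise_cat pwQ pwQs !andbT /=.
  apply/allrelP => z z' zQ /flattenP[_ /mapP[v' v'vs ->] zQ'].
  have Rv' := sub _ v'vs; have [/andP[/andP[/allP linkQ' _] /allP fQ'] _] := QP _ Rv'.
  have neq : v != v' by apply: contraNneq nvs => ->.
  have /andP[/eqP zv sz] := fQ _ zQ; have /andP[/eqP zv' sz'] := fQ' _ zQ'.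
  have /and5P[_ _ _ szq /and3P[pz uz avz]] := allP linkQ _ zQ.
  have /and5P[_ _ _ szq' /and3P[pz' uz' avz']] := linkQ' _ zQ'.
  rewrite zv in pz; rewrite zv' in pz'.
  apply/andP; split.
    rewrite /joins zv zv' (negPf neq) /=; apply/negP => /andP[_ /eqP zw].
    by rewrite zw in pz; apply: (notconn v v' z.2).
  apply/hasPn => x xz; apply/negP => xz'.
  (* At a common internal vertex [x], the two initial segments splice into a path from [v] to [v']
     with at most [2 * r] internal vertices; this is why [q] is [2 * r]. *)
  case/splitPr: xz pz sz avz => p1 p2 pz sz avz.
  case/splitPr: xz' pz' sz' avz' => p1' p2' pz' sz' avz'.
  apply: (notconn v v' (p1 ++ x :: rev p1')) => //.
  - move: pz pz'; rewrite !rcons_cat !cat_path /= => /and3P[-> -> _].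
    move=> /and3P[pp1 px _]; have : path (@adj G) v' (rcons p1' x) by rewrite rcons_path pp1.
    by move=> /path_rcons_rev.
  - rewrite size_cat /= size_rev /q mul2n -addnn leq_add //.
      by apply: leq_trans sz; rewrite size_cat leq_addr.
    by apply: leq_trans sz'; rewrite size_cat /= addnS ltnS leq_addr.
  - move: avz avz'; rewrite !all_cat /= all_rev => /and3P[-> -> _].
    by case/andP.
have := sparse sysQ.
have : #|R| * b.+1 <= size (flatten [seq Q v | v <- enum R]).
  rewrite cardE; have : {subset enum R <= R} by move=> v; rewrite mem_enum.
  elim: (enum R) => //= v vs IHvs sub; rewrite mulSn size_cat leq_add //.
    by case: (QP v (sub _ (mem_head _ _))).
  by apply: IHvs => x xv; apply: sub; rewrite inE xv orbT.
have R0 : 0 < #|R|.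
  by rewrite lt0n; apply: contraNneq S0 => R0; move: leR; rewrite R0 muln0 leqn0 cards_eq0.
have leU : 2 * #|U| <= #|S| * (2 + c * q).
  have := (leq_card_setU S M).1; rewrite -/U -(leq_pmul2l (isT : 0 < 2)) => /leq_trans; apply.
  by rewrite mulnDr [in X in _ <= X]mulnDr [2 * #|S|]mulnC leq_add2l mulnA [#|S| * c]mulnC.
move: (size _) => n leRb le_n.
(* The count combines [2 * n <= c * #|U|], the bound on [2 * #|U|] and [#|S| <= c.+1 * #|R|]; [b] is
   chosen so that [c * c.+1 * (2 + c * q) <= 2 * b]. *)
have : 4 * (#|R| * b.+1) <= 2 * (#|R| * b).
  apply: (@leq_trans (2 * (2 * n))); first by rewrite [leqRHS]mulnA (leq_mul (leqnn 4) leRb).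
  apply: (@leq_trans (c * (2 * #|U|))); first by rewrite [leqRHS]mulnCA leq_mul2l le_n.
  apply: (@leq_trans (c * (c.+1 * #|R| * (2 + c * q)))).
    by rewrite leq_mul2l (leq_trans leU) ?orbT // leq_mul2r leR orbT.
  rewrite def_b (mulnC q); clear; lia.
rewrite leqNgt => /negP; apply; rewrite mulnS; clear -R0; lia.
Qed.
End Dense.

(** * The strategy of the flipper *)

(** Vertices are removed one by one, the first removed getting the largest rank; the set present
    when [v] is removed is then exactly the set of vertices ranked at most [v]. *)
Lemma rank_exists (V : finType) (Q : {set V} -> V -> Prop) :
  (forall S : {set V}, S != set0 -> exists2 v, v \in S & Q S v) ->
  exists2 rk : V -> nat, injective rk & forall v, Q [set w | rk w <= rk v] v.
Proof.
move=> exQ; suff: forall n (S : {set V}), #|S| = n -> exists rk : V -> nat,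
    [/\ {in S &, injective rk}, forall v, v \in S -> rk v < n &
        forall v, v \in S -> Q [set w in S | rk w <= rk v] v].
  move=> /(_ _ [set: V] erefl)[rk [rk_inj _ rkQ]].
  exists rk => [v w|v]; first exact: rk_inj.
  by have := rkQ v (in_setT v); congr (Q _ _); apply/setP => w; rewrite !inE.
elim=> [|n IHn] S cS.
  have S0 : S = set0 by apply/eqP; rewrite -cards_eq0 cS.
  by exists (fun=> 0); rewrite S0; split=> v; rewrite inE.
have [|v Sv Qv] := exQ S; first by rewrite -card_gt0 cS.
have [|rk [rk_inj rk_lt rkQ]] := IHn (S :\ v); first by have := cardsD1 v S; rewrite Sv cS; lia.
have rk_ltD w : w \in S -> w != v -> rk w < n by move=> Sw neq; rewrite rk_lt // !inE neq.
exists (fun w => if w == v then n else rk w); split=> [w u Sw Su|w Sw|w Sw] /=.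
- case: (eqVneq w v) => [->|nw]; case: (eqVneq u v) => [->|nu] //.
  + by move=> eq_n; have := rk_ltD _ Su nu; rewrite -eq_n ltnn.
  + by move=> eq_n; have := rk_ltD _ Sw nw; rewrite eq_n ltnn.
  + by apply: rk_inj; rewrite !inE ?nw ?nu.
- by case: (eqVneq w v) => // nw; rewrite ltnS ltnW // rk_ltD.
case: (eqVneq w v) => [eq_wv|neq] //.
- rewrite eq_wv; congr (Q _ _): Qv; apply/setP => u; rewrite !inE; case: (eqVneq u v) => [eq_uv|nu];
    rewrite ?leqnn ?andbT //.
  by case Su: (u \in S) => //=; rewrite ltnW // rk_ltD.
have Sw' : w \in S :\ v by rewrite !inE neq.
have := rkQ w Sw'; congr (Q _ _); apply/setP => u; rewrite !inE.
case: (eqVneq u v) => [eq_uv|nu] //=; rewrite leqNgt rk_lt // andbF //.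
Qed.

(** The geometric sum K + K^2 + ... + K^d. *)
Fixpoint reach_bound K d := if d is d'.+1 then K + K * reach_bound K d' else 0.

(** Since [x] is ranked below [u], a simple path from [u] to [x] meets [M u]. Either [x] is met
    there, or the path restarts from a vertex of [M u] still ranked at least [m], with at least one
    step fewer. Fixing [m] while [u] varies makes the induction on [d] work. *)
Lemma strong_reach (G : graph) (rk : vert G -> nat) r K (M : vert G -> {set vert G}) :
  (forall v, #|M v| <= K /\ hits r [set w | rk w <= rk v] v (M v)) ->
  forall m d u, d <= r -> rk m <= rk u ->
  exists2 Y : {set vert G}, #|Y| <= reach_bound K d &
    forall s x, path (@adj G) u s -> size s <= d -> x \in s -> rk x < rk m ->
      {in s, forall y, y != x -> rk m <= rk y} -> x \in Y.
Proof.
move=> MP m; elim=> [|d IHd] u le_d mu.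
  by exists set0; rewrite ?cards0 // => -[|? ?].
(* A vertex ranked below [m] gets the empty set, as no path restarts from it. *)
have /fin_all_exists[Y YP] : forall y, exists Y : {set vert G}, #|Y| <= reach_bound K d /\
    (rk m <= rk y -> forall s x, path (@adj G) y s -> size s <= d -> x \in s -> rk x < rk m ->
      {in s, forall y, y != x -> rk m <= rk y} -> x \in Y).
  move=> y; have [my|_] := leqP (rk m) (rk y); last by exists set0; rewrite cards0.
  by have [Y cY YP] := IHd y (ltnW le_d) my; exists Y.
have [cM hM] := MP u.
exists (M u :|: \bigcup_(y in M u) Y y).
  rewrite (leq_trans (leq_card_setU _ _).1) //= leq_add // (@leq_trans (#|M u| * reach_bound K d)) //.
    by apply: leq_card_bigcup => y _; case: (YP y).
  by rewrite leq_mul2r cM orbT.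
move=> s x ps ss xs xm ge_m.
have [xM|nxM] := boolP (x \in M u); first by rewrite inE xM.
(* loop removal, keeping [x] as the last vertex *)
case/splitPr: xs ps ss ge_m => s1 s2; rewrite -cat_rcons cat_path size_cat => /andP[ps _] ss ge_m.
have neq : u != x by apply: contraTneq xm => <-; rewrite -leqNgt.
have [p [pp up sp sub]] := path_uniq_rcons ps neq.
have {}sp : size (rcons p x) <= d.+1.
  by rewrite (leq_trans _ ss) // size_rcons (leq_trans _ (leq_addr _ _)) // size_rcons ltnS.
have {}sub : {subset p <= s1 ++ x :: s2} by move=> y /sub; rewrite mem_cat => ->.
have [|y yp yM] := hasP (hM _ pp (leq_trans sp le_d) up _).
  by apply/hasP; exists x; rewrite ?mem_rcons ?mem_head // !inE (leq_trans (ltnW xm)).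
have ge_mp z : z \in p -> rk m <= rk z.
  move=> zp; apply: ge_m; first by rewrite cat_rcons sub.
  by apply: contraTneq up => <-; rewrite /= rcons_uniq zp andbF.
rewrite inE; apply/orP; right; apply/bigcupP; exists y => //.
move: yp; rewrite mem_rcons inE => /orP[/eqP eq_yx|yp]; first by rewrite -eq_yx yM in nxM.
have [_ /(_ (ge_mp _ yp))] := YP y.
case/splitPr: yp pp sp ge_mp => p1 p2; rewrite rcons_cat cat_path size_cat /=.
move=> /and3P[_ _ pp] sp ge_mp.
apply; [exact: pp| | |by []|].
- by rewrite -ltnS (leq_trans _ sp) // addnS ltnS leq_addl.
- by rewrite mem_rcons mem_head.
move=> z; rewrite mem_rcons inE => /orP[/eqP->|zp _]; first by rewrite eqxx.
by apply: ge_mp; rewrite mem_cat inE zp !orbT.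
Qed.

Definition isolate (G : graph) (S : {set vert G}) : rel (vert G) :=
  fun x y => [&& adj x y, x \notin S & y \notin S].

(** The part of a vertex records its position in [S] and its neighbourhood in [S]. Flipping the part
    of each vertex of [S] with the parts of its neighbours deletes exactly the edges meeting [S]. *)
Lemma isolate_kflip s (G : graph) (S : {set vert G}) :
  #|S| <= s -> is_kflip #|{: option 'I_s * {set 'I_s}}| (isolate S).
Proof.
move=> leS; pose e := enum S.
(* A vertex outside [S] has index [size e], possibly below [s]. This is harmless: past the end of
   [e], [nth] returns [x] itself, which is not adjacent to [x]. *)
pose code x : option 'I_s * {set 'I_s} :=
  (insub (index x e), [set i : 'I_s | adj x (nth x e i)]).
pose f (p p' : option 'I_s * {set 'I_s}) := if p.1 is Some i then i \in p'.2 else false.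
exists (fun x => enum_rank (code x)).
exists (fun i j => f (enum_val i) (enum_val j) || f (enum_val j) (enum_val i)); split.
  by move=> i j; rewrite orbC.
have fP x y : f (code x) (code y) = (x \in S) && adj x y.
  rewrite /f /code /=; case: insubP => [i _ def_i|].
    rewrite inE def_i; have [Sx|nSx] := boolP (x \in S).
      by rewrite nth_index ?mem_enum // adj_sym.
    by rewrite memNindex ?mem_enum // nth_default // adj_irr.
  rewrite -leqNgt => le_i; case: (boolP (x \in S)) => // Sx.
  have : index x e < size e by rewrite index_mem mem_enum.
  by rewrite -cardE ltnNge (leq_trans leS).
move=> x y; rewrite !enum_rankK !fP /isolate (adj_sym y x).
have [<-|_] /= := eqVneq x y; first by rewrite adj_irr.
by case: adj; case: (x \in S); case: (y \in S).
Qed.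

Lemma exists_min (T : Type) (rk : T -> nat) (Q : T -> Prop) :
  (exists x, Q x) -> exists2 x, Q x & forall y, Q y -> rk x <= rk y.
Proof.
move=> [x Qx]; have [n] := ubnP (rk x); elim: n x Qx => // n IHn x Qx lt_n.
have [[y [Qy lt_y]]|noy] := classic (exists y, Q y /\ rk y < rk x).
  by apply: (IHn y Qy); lia.
by exists x => // y Qy; rewrite leqNgt; apply/negP => lt_y; apply: noy; exists y.
Qed.

Lemma within_mem (V : finType) (E : rel V) r v s y :
  path E v s -> size s <= r -> y \in v :: s -> within E r v y.
Proof.
move=> ps ss; rewrite inE => /orP[/eqP->|ys]; first by exists [::].
case/splitPr: ys ps ss => s1 s2; rewrite -cat_rcons cat_path size_cat => /andP[ps1 _] ss.
by exists (rcons s1 y); rewrite last_rcons ps1 (leq_trans _ ss) ?leq_addr.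
Qed.

Lemma flipper_wins_strong_reach (G : graph) (rk : vert G -> nat) r s :
  injective rk ->
  (forall m, exists2 S : {set vert G}, #|S| <= s & m \in S /\
     forall p x, path (@adj G) m p -> size p <= 3 * r -> x \in p -> rk x < rk m ->
      {in p, forall y, y != x -> rk m <= rk y} -> x \in S) ->
  flipper_wins r #|{: option 'I_s * {set 'I_s}}| G.
Proof.
move=> rk_inj SP; set k := #|_|; pose N := \max_v rk v.
(* The minimal rank [rk m] in the ball of the runner is at most [N] and strictly increases, so
   [N - rk m] decreases. *)
suff win n (E : rel (vert G)) v m : symmetric E -> subrel E (@adj G) ->
    within E r v m -> (forall w, within E r v w -> rk m <= rk w) ->
    N - rk m < n -> flipper_wins_from r k E v.
  move=> v; have [|m vm minm] := @exists_min _ rk (within (@adj G) r v).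
    by exists v, [::].
  exact: (win _ _ _ m (@adj_sym G) _ vm minm (leqnn _)).
elim: n E v m => // n IHn E v m symE subE vm minm; rewrite ltnS => le_n.
have [S cS [Sm hS]] := SP m.
have symI : symmetric (isolate S) by move=> x y; rewrite /isolate adj_sym (andbC (x \notin S)).
have subI : subrel (isolate S) (@adj G) by move=> x y /and3P[].
apply: (FW_step (isolate_kflip cS)) => w vw.
have [Sw|nSw] := boolP (w \in S); first by left=> y; rewrite /isolate Sw andbF.
right; have [|m' wm' minm'] := @exists_min _ rk (within (isolate S) r w).
  by exists w, [::].
apply: (IHn _ w m' symI subI wm' minm').
suff lt_m : rk m < rk m'.
  have le_N : rk m' <= N by exact: leq_bigmax.
  by apply: leq_trans le_n; apply: ltn_sub2l => //; apply: leq_trans lt_m le_N.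
(* The walk from [m] back to [v], on to [w] and then to [m'] has length at most [3 * r]. Its first
   two legs lie in the old ball, so its first vertex ranked below [m] is on the third leg. That
   vertex belongs to [S] by strong reachability, but the third leg avoids [S]. *)
move: vm vw wm' => [s1 [ss1 ps1 ls1]] [s2 [ss2 ps2 ls2]] [s3 [ss3 ps3 ls3]].
have ge1 y : y \in v :: s1 -> rk m <= rk y by move=> /(within_mem ps1 ss1) /minm.
have ge2 y : y \in v :: s2 -> rk m <= rk y by move=> /(within_mem ps2 ss2) /minm.
have nS3 y : y \in w :: s3 -> y \notin S.
  rewrite inE => /orP[/eqP->//|]; clear - ps3.
  elim: s3 w ps3 => //= z s3 IHs w /andP[/and3P[_ _ nSz] ps3].
  by rewrite inE => /orP[/eqP->//|]; apply: IHs ps3.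
rewrite ltnNge; apply/negP => le_m.
have neq : m' != m by apply: contraTneq Sm => <-; apply: nS3; rewrite -ls3 mem_last.
have {le_m neq} lt_m : rk m' < rk m by rewrite ltn_neqAle le_m andbT (inj_eq rk_inj).
pose s1' := rev (belast v s1).
have ps1' : path E m s1'.
  by rewrite -ls1 /s1' rev_path; apply: sub_path ps1 => x y; rewrite symE.
have ls1' : last m s1' = v.
  by rewrite /s1'; case: (s1) ls1 => [|y s4] /= ls; rewrite ?ls // rev_cons last_rcons.
pose p := s1' ++ s2 ++ s3.
have pp : path (@adj G) m p.
  rewrite /p !cat_path ls1' ls2 (sub_path subE ps1') (sub_path subE ps2).
  exact: sub_path subI _ _ ps3.
have sp : size p <= 3 * r.
  by rewrite /p !size_cat size_rev size_belast !mulSn mul0n addn0 !leq_add.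
have lp : last m p = m' by rewrite /p !last_cat ls1' ls2.
have : has (fun y => rk y < rk m) p.
  apply/hasP; exists m' => //; have := mem_last m p; rewrite lp inE.
  by case/predU1P=> // eq_m; rewrite eq_m ltnn in lt_m.
move=> /first_hit[a [x [b [def_p xm ha]]]].
have : x \in p by rewrite def_p mem_cat mem_head orbT.
rewrite /p !mem_cat mem_rev => /or3P[x1|x2|x3].
- by move: xm; rewrite ltnNge ge1 ?mem_belast.
- by move: xm; rewrite ltnNge ge2 // inE x2 orbT.
have nSx : x \notin S by apply: nS3; rewrite inE x3 orbT.
case/negP: nSx.
rewrite def_p -cat_rcons cat_path size_cat in pp sp.
apply: (hS (rcons a x)) => //.
- by case/andP: pp.
- exact: leq_trans (leq_addr _ _) sp.
- by rewrite mem_rcons mem_head.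
move=> y; rewrite mem_rcons inE => /orP[/eqP->|/(allP ha)]; first by rewrite eqxx.
by rewrite /= -leqNgt.
Qed.

(** With t = c + 1, [K_{t,t}] is an unsubdivided minor with t^2 edges on 2t vertices, too dense for
    the bound [c]. *)
Lemma weakly_sparse_of_bounded_expansion (C : graph_class) :
  bounded_expansion C -> weakly_sparse C.
Proof.
move=> /(_ 0)[c ltc]; exists c.+1 => G CG [A [B [dAB cA cB adjAB]]].
pose L := [seq (a, b, [::] : seq (vert G)) | a <- enum A, b <- enum B].
have : link_system 0 (A :|: B) L.
  apply/andP; split.
    apply/allP => _ /allpairsP[[a b] [/= Aa Bb ->]]; rewrite !mem_enum in Aa Bb.
    rewrite /is_link /= !inE Aa Bb orbT adjAB // !andbT /=.
    by apply: contraTneq Aa => ->; rewrite (disjointFl dAB Bb).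
  apply: (@sub_in_pairwise _ [in L] (fun z z' => z != z')); last 2 first.
  - exact/allP.
  - rewrite -uniq_pairwise; apply: allpairs_uniq; rewrite ?enum_uniq //.
    by move=> [a b] [a' b'] _ _ [-> ->].
  move=> _ _ /allpairsP[[a b] [/= Aa Bb ->]] /allpairsP[[a' b'] [/= Aa' Bb' ->]] neq.
  rewrite !mem_enum in Aa Bb Aa' Bb'; rewrite /compatible /joins /= andbT negb_or.
  apply/andP; split; first by apply: contraNN neq => /andP[/eqP-> /eqP->].
  by apply/negP => /andP[/eqP eq_ab _]; move: Aa; rewrite eq_ab (disjointFl dAB Bb').
move=> /link_system_minor[H minorH [cH leH]].
have := ltc _ _ CG minorH; rewrite cH.
have := (leq_card_setU A B).1; rewrite cA cB.
rewrite size_allpairs -!cardE cA cB in leH; nia.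
Qed.

Lemma bounded_flip_width_of_bounded_expansion (C : graph_class) :
  bounded_expansion C -> bounded_flip_width C.
Proof.
(* The three legs of the walk need reachability up to [3 * r], and hitting sets at that radius need
   links with twice as many internal vertices. *)
move=> BE r; have [c ltc] := BE (2 * (3 * r)).
pose K := c * (c.+1 * (1 + (2 * (3 * r)) * c)) * (3 * r).+1.
(* The successor makes room for [m] itself in the isolated set. *)
exists #|{: option 'I_(reach_bound K (3 * r)).+1 * {set 'I_(reach_bound K (3 * r)).+1}}| => G CG.
have sparse (B : {set vert G}) L : link_system (2 * (3 * r)) B L -> 2 * size L <= c * #|B|.
  move=> /link_system_minor[H minorH [<- leL]].
  by apply: leq_trans (ltc _ _ CG minorH); rewrite leq_mul2l.
have [rk rk_inj rkP] := rank_exists (@hitting_set _ _ _ sparse).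
have /fin_all_exists[M MP] : forall v, exists M : {set vert G},
    #|M| <= K /\ hits (3 * r) [set w | rk w <= rk v] v M.
  by move=> v; have [M] := rkP v; exists M.
apply: flipper_wins_strong_reach rk_inj _ => m.
have [Y cY YP] := strong_reach MP (leqnn (3 * r)) (leqnn (rk m)).
exists (m |: Y); first by rewrite (leq_trans (leq_card_setU _ _).1) // cards1 add1n ltnS.
rewrite setU11; split=> // p x pp sp xp xm gep.
by rewrite inE (YP p x) ?orbT.
Qed.

Theorem mainTheorem8 (C : graph_class) :
  bounded_expansion C <-> (weakly_sparse C /\ bounded_flip_width C).
Proof.
split=> [BE|[]]; last exact: bounded_expansion_of_flip_width.
split; first exact: weakly_sparse_of_bounded_expansion.
exact: bounded_flip_width_of_bounded_expansion.
Qed.
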